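(* Let $\boldsymbol{k}=(k_1,\dots,k_r)$ be an index. As $N\to+\infty$, $$\zeta_{(0,N)}(\boldsymbol{k};s)=\zeta_*^{T_N-H(s)}(\boldsymbol{k};s)+O_{\boldsymbol{k},K}\left(\frac{(1+\log N)^{r-1}}{N}\right)$$ uniformly for $s$ in every compact subset $K\subset\mathcal L=\{s\in\mathbb C:|\operatorname{Re}(s)|<\tfrac12\}$.
   Context: An index is a finite sequence $\boldsymbol{k}=(k_1,\dots,k_r)$ of positive integers (depth $r$); $\varnothing$ is the empty index. An index is admissible if it is empty or its last entry is $\geqslant2$. For $N\geqslant1$, $\zeta_{(0,N)}(\boldsymbol{k};s)=\sum_{0<n_1<\cdots<n_r<N}\prod_{i=1}^r(n_i+s)^{-k_i}$, and $T_N=\sum_{n=1}^{N-1}\frac1n$. Stuffle regularization. For a nonempty admissible index $\boldsymbol{a}=(a_1,\dots,a_d)$, $\zeta(\boldsymbol{a};s)=\sum_{0<n_1<\cdots<n_d}\prod_{i}(n_i+s)^{-a_i}$, and $\zeta(\varnothing;s)=1$. On the $\mathbb Q$-span $\mathfrak H^1_*$ of all indices, the stuffle product $*$ is bilinear with unit $\varnothing$ and $(a,\boldsymbol{\alpha})*(b,\boldsymbol{\beta})=(a,\boldsymbol{\alpha}*(b,\boldsymbol{\beta}))+(b,(a,\boldsymbol{\alpha})*\boldsymbol{\beta})+(a+b,\boldsymbol{\alpha}*\boldsymbol{\beta})$; $\mathfrak H^0_*$ is the span of admissible indices. It is known that every index of depth $r$ has a unique decomposition $\boldsymbol{k}=\sum_{l=0}^r\boldsymbol{u}_l*(1)^{*l}$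 with $\boldsymbol{u}_l\in\mathfrak H^0_*$, where every index occurring in $\boldsymbol{u}_l$ has depth at most $r-l$. Define $\zeta_*^X(\boldsymbol{k};s)=\sum_{l=0}^r\zeta(\boldsymbol{u}_l;s)X^l$ (with $\zeta(\cdot;s)$ extended linearly); equivalently, $\zeta_*^X(\cdot;s)$ is the unique stuffle homomorphism extending $\zeta(\cdot;s)$ on admissible indices with $\zeta_*^X(1;s)=X$. Harmonic number function: $H(s)=\int_0^1\frac{1-t^s}{1-t}\,dt=\psi(1+s)+\gamma=\sum_{n\geqslant1}\bigl(\frac1n-\frac1{n+s}\bigr)$. *)

(* Defs.v *)
From HB Require Import structures.
From mathcomp Require Import all_boot all_order all_algebra.
From mathcomp Require Import all_classical all_reals all_analysis.
From mathcomp Require Import complex freeg.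

Set Implicit Arguments.
Unset Strict Implicit.
Unset Printing Implicit Defensive.

Import Order.TTheory GRing.Theory Num.Theory numFieldNormedType.Exports.

Local Open Scope classical_set_scope.
Local Open Scope ring_scope.
Local Open Scope complex_scope.

Definition is_index (k : seq nat) : bool := all (leq 1) k.

(* The default 2 makes the empty index admissible. *)
Definition admissible (k : seq nat) : bool :=
  is_index k && (1 < last 2 k)%N.

(* Formal rational combinations of words in nat.  The Q-span of the indices is
   the subspace of those supported on words satisfying [is_index]. *)
Definition words := {freeg (seq nat) / rat}.

Definition in_H0 (u : words) : bool := all admissible (dom u).

Definition depth_le (d : nat) (u : words) : bool :=
  all (fun a : seq nat => (size a <= d)%N) (dom u).

(* The words occurring in the stuffle product of two words, listed with
   multiplicity. *)
Fixpoint stuffle_words (u : seq nat) : seq nat -> seq (seq nat) :=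
  fix stuffle_u (v : seq nat) : seq (seq nat) :=
    match u, v with
    | [::], _ => [:: v]
    | _, [::] => [:: u]
    | a :: u', b :: v' =>
        map (cons a) (stuffle_words u' v)
        ++ map (cons b) (stuffle_u v')
        ++ map (cons (a + b)%N) (stuffle_words u' v')
    end.

Definition stuffle (x y : words) : words :=
  fglift (fun u => fglift (fun v =>
    \sum_(w <- stuffle_words u v) << w >> : words) y) x.

Definition stuffle_exp (x : words) (l : nat) : words :=
  iter l (stuffle x) << [::] >>.

Definition is_stuffle_decomp (k : seq nat)
    (u : {ffun 'I_(size k).+1 -> words}) : Prop :=
  (forall l, in_H0 (u l) /\ depth_le (size k - l) (u l)) /\
  << k >> = \sum_l stuffle (u l) (stuffle_exp << [:: 1%N] >> l).

(* Such a decomposition exists and is unique when k is an index; the default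
   value 0 of [xget] only concerns other words. *)
Definition stuffle_decomp (k : seq nat) : {ffun 'I_(size k).+1 -> words} :=
  xget [ffun=> 0] [set u | is_stuffle_decomp u].

Section Zeta.
Variable R : realType.
Implicit Types (s X : R[i]) (k a : seq nat) (N : nat).

(* [path ltn 0 n] says 0 < n_1 < ... < n_r. *)
Definition zeta_trunc N k s : R[i] :=
  \sum_(n : (size k).-tuple 'I_N | path ltn 0%N (map val n))
    \prod_(i < size k) ((val (tnth n i))%:R + s) ^- nth 0%N k i.

(* R[i]^o carries the topology of the complex modulus. *)
Definition zeta a s : R[i] :=
  lim ((fun N => zeta_trunc N a s : R[i]^o) @ \oo).

Definition zeta_lin (u : words) s : R[i] :=
  \sum_(a <- dom u) ratr (coeff a u) * zeta a s.

Definition zeta_star X k s : R[i] :=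
  \sum_(l < (size k).+1) zeta_lin (stuffle_decomp k l) s * X ^+ l.

Definition harmonic_trunc N : R[i] := \sum_(1 <= n < N) n%:R^-1.

Definition harmonic_fun s : R[i] :=
  lim ((fun N => \sum_(1 <= n < N) (n%:R^-1 - (n%:R + s)^-1) : R[i]^o) @ \oo).

Definition strip : set R[i] := [set s | `|complex.Re s| < 2^-1].

End Zeta.

(* Main.v *)
Require Import Defs.
From HB Require Import structures.
From mathcomp Require Import all_boot all_order all_algebra.
From mathcomp Require Import all_classical all_reals all_analysis.
From mathcomp Require Import ssrAC.
From mathcomp Require Import complex freeg ring lra.

(** The truncated sums are values of monomial quasi-symmetric functions at the
    points 1 / (n + s), 0 < n < N, hence multiplicative for the stuffle product
    ([qsym_stuffle]).  Evaluating the decomposition of k along powers of (1),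
    with coefficients u_l of depth at most r - l, gives the exact identity
    ([lin_eval_decomp])

      zeta_(0,N)(k; s) = sum_l zeta_(0,N)(u_l; s) zeta_(0,N)(1; s)^l,

    while the regularized value at X = T_N - H(s) is the sum of the terms
    zeta(u_l; s) X^l.  It remains to compare the factors.

    For an admissible index of depth d, the tail of the series is dominated by
    the sum over n >= N of (1 + log n)^{d-1} / n^2, that is, by a multiple of
    (1 + log N)^{d-1} / N ([succ_ln_tail], [zeta_dist]).  In depth one, the
    difference of zeta_(0,N)(1; s) and X is the tail of the series that defines
    H(s), which is O(1/N) on bounded sets ([harmonic_fun_dist]).  All these
    bounds rest on |1 / (n + s)| <= 2 / n on the strip, hence are uniform in s;
    the bound on |s| comes from the compactness of K.  As zeta_(0,N)(1; s) and X are
    O(1 + log N), the l-th term differs from its limit by at most a multiple of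
    (1 + log N)^{r-l-1} / N times (1 + log N)^l, plus (1 + log N)^{l-1} / N
    ([uniformO_zeta_star]).

    The decomposition exists because (1) * v contains the word v followed by 1
    with a positive coefficient, and otherwise only words with fewer trailing
    ones ([index_decomposable]); this needs the stuffle product to be
    commutative and associative ([stuffleC], [stuffleA]). *)

Set Implicit Arguments.
Unset Strict Implicit.
Unset Printing Implicit Defensive.

Import Order.TTheory GRing.Theory Num.Theory numFieldNormedType.Exports.

Local Open Scope classical_set_scope.
Local Open Scope ring_scope.
Local Open Scope complex_scope.

(** * The stuffle algebra *)

Lemma fgliftB (V : lmodType rat) (f : seq nat -> V) :
  {morph fglift f : u v / u - v}.
Proof. exact: lift_is_additive. Qed.

Lemma fglift0 (V : lmodType rat) (f : seq nat -> V) :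
  fglift f 0 = 0.
Proof. by rewrite -[0 in LHS](subrr 0) fgliftB subrr. Qed.

Lemma fgliftD (V : lmodType rat) (f : seq nat -> V) :
  {morph fglift f : u v / u + v}.
Proof. by move=> u v; rewrite -[v in LHS]opprK -(sub0r v) !fgliftB fglift0 sub0r opprK. Qed.

Lemma fglift_basis (V : lmodType rat) (f : seq nat -> V) w : fglift f << w >> = f w.
Proof. by rewrite liftU scale1r. Qed.

Lemma fglift_expand (V : lmodType rat) (f : seq nat -> V) (u : words) :
  fglift f u = \sum_(w <- dom u) coeff w u *: f w.
Proof.
rewrite -{1}[u]freeg_sumE (big_morph _ (fgliftD f) (fglift0 f)).
by apply: eq_bigr => w _; rewrite liftU.
Qed.

Lemma scale_word (c : rat) (w : seq nat) : c *: << w >> = << c *g w >> :> words.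
Proof. by apply/eqP/freeg_eqP => v; rewrite coeffZ !coeffU mul1r. Qed.

Lemma word_sumE (u : words) : u = \sum_(w <- dom u) coeff w u *: << w >>.
Proof. by rewrite -{1}[u]freeg_sumE; apply: eq_bigr => w _; rewrite scale_word. Qed.

Lemma fgliftZ (V : lmodType rat) (f : seq nat -> V) c u :
  fglift f (c *: u) = c *: fglift f u.
Proof.
rewrite [u in LHS]word_sumE scaler_sumr (big_morph _ (fgliftD f) (fglift0 f)).
rewrite fglift_expand scaler_sumr; apply: eq_bigr => w _.
by rewrite scalerA scale_word liftU scalerA.
Qed.

Lemma fglift_linear (V : lmodType rat) (f : seq nat -> V) : linear (fglift f : words -> V).
Proof. by move=> c u v; rewrite fgliftD fgliftZ. Qed.

HB.instance Definition _ (V : lmodType rat) (f : seq nat -> V) :=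
  GRing.isLinear.Build rat words V _ (fglift f) (@fglift_linear V f).

Lemma stuffleDl x y z : stuffle (x + y) z = stuffle x z + stuffle y z.
Proof. exact: linearD. Qed.

Lemma stuffleZl c x y : stuffle (c *: x) y = c *: stuffle x y.
Proof. exact: linearZZ. Qed.

Lemma stuffle_linear_r x : linear (stuffle x).
Proof.
move=> c u v; rewrite /stuffle !fglift_expand scaler_sumr -big_split /=.
by apply: eq_bigr => w _; rewrite linearP scalerDr !scalerA mulrC.
Qed.

HB.instance Definition _ (x : words) :=
  GRing.isLinear.Build rat words words _ (stuffle x) (stuffle_linear_r x).

(** Every linear identity below is proved with this principle: check it on
    words, then note that both sides commute with sums and scalings. *)
Lemma words_ind (P : words -> Prop) :
  (forall w, P << w >>) -> (forall c x, P x -> P (c *: x)) ->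
  (forall x y, P x -> P y -> P (x + y)) -> forall x, P x.
Proof.
move=> Pw PZ PD x; rewrite [x]word_sumE.
apply: (big_ind P) => // [|w _]; last by apply/PZ/Pw.
by rewrite -(scale0r << [::] >>); apply/PZ/Pw.
Qed.

(** Prepending a letter is what turns the combinatorial recursion of
    [stuffle_words] into a recursion between elements of the algebra. *)
Definition prepend (a : nat) : words -> words := fglift (fun w => << a :: w >>).

Lemma prependD a x y : prepend a (x + y) = prepend a x + prepend a y.
Proof. exact: fgliftD. Qed.

Lemma prependZ a c x : prepend a (c *: x) = c *: prepend a x.
Proof. exact: fgliftZ. Qed.

Lemma prepend_sum a (I : Type) (r : seq I) (F : I -> words) :
  prepend a (\sum_(i <- r) F i) = \sum_(i <- r) prepend a (F i).
Proof. by apply: big_morph => [x y|]; [exact: prependD | exact: fglift0]. Qed.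

Lemma stuffleDr x y z : stuffle x (y + z) = stuffle x y + stuffle x z.
Proof. exact: linearD. Qed.

Lemma stuffleZr c x y : stuffle x (c *: y) = c *: stuffle x y.
Proof. exact: linearZZ. Qed.

Definition bilinD := (prependD, stuffleDl, stuffleDr).
Definition bilinZ := (prependZ, stuffleZl, stuffleZr).

Lemma prepend_word a w : prepend a << w >> = << a :: w >>.
Proof. exact: fglift_basis. Qed.

Lemma stuffle_word u v :
  stuffle << u >> << v >> = \sum_(w <- stuffle_words u v) << w >>.
Proof. by rewrite /stuffle !fglift_basis. Qed.

Lemma stuffle_nil_l x : stuffle << [::] >> x = x.
Proof.
elim/words_ind: x => [w|c x IH|x y IHx IHy].
- by rewrite stuffle_word; case: w => [|a w] /=; rewrite big_seq1.
- by rewrite stuffleZr IH.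
by rewrite stuffleDr IHx IHy.
Qed.

Lemma stuffle_nil_r x : stuffle x << [::] >> = x.
Proof.
elim/words_ind: x => [w|c x IH|x y IHx IHy].
- by rewrite stuffle_word; case: w => [|a w] /=; rewrite big_seq1.
- by rewrite stuffleZl IH.
by rewrite stuffleDl IHx IHy.
Qed.

Lemma stuffle_cons a u b v :
  stuffle << a :: u >> << b :: v >> =
    prepend a (stuffle << u >> << b :: v >>)
    + prepend b (stuffle << a :: u >> << v >>)
    + prepend (a + b) (stuffle << u >> << v >>).
Proof.
rewrite !stuffle_word /= !big_cat !big_map /= addrA !prepend_sum /=.
by congr (_ + _ + _); apply: eq_bigr => w _; rewrite prepend_word.
Qed.

Lemma addrACA3 (V : nmodType) (a b c a' b' c' : V) :
  a + b + c + (a' + b' + c') = (a + a') + (b + b') + (c + c').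
Proof. by rewrite addrACA; congr (_ + _); rewrite addrACA. Qed.

(** The defining recursion of the stuffle product, extended from words to
    arbitrary combinations: this is the form in which it can be applied to a
    product that is itself a factor. *)
Lemma stuffle_prepend a x b y :
  stuffle (prepend a x) (prepend b y) =
    prepend a (stuffle x (prepend b y))
    + prepend b (stuffle (prepend a x) y)
    + prepend (a + b) (stuffle x y).
Proof.
elim/words_ind: x => [u|c x IH|x1 x2 IH1 IH2]; last 2 first.
- by rewrite !bilinZ -!scalerDr IH.
- by rewrite !bilinD IH1 IH2 addrACA3.
elim/words_ind: y => [v|c y IH|y1 y2 IH1 IH2].
- by rewrite !prepend_word stuffle_cons.
- by rewrite !bilinZ -!scalerDr IH.
by rewrite !bilinD IH1 IH2 addrACA3.
Qed.

Lemma stuffleC x y : stuffle x y = stuffle y x.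
Proof.
elim/words_ind: x => [u|c x IH|x1 x2 IH1 IH2]; last 2 first.
- by rewrite !bilinZ IH.
- by rewrite !bilinD IH1 IH2.
elim/words_ind: y => [v|c y IH|y1 y2 IH1 IH2]; last 2 first.
- by rewrite !bilinZ IH.
- by rewrite !bilinD IH1 IH2.
elim: u v => [|a u IHu] v; first by rewrite stuffle_nil_l stuffle_nil_r.
elim: v => [|b v IHv]; first by rewrite stuffle_nil_l stuffle_nil_r.
rewrite !stuffle_cons !IHu IHv addnC; congr (_ + _).
by rewrite addrC.
Qed.

(** Nested induction on the three words.  Expanding both sides gives one term for
    each way of choosing the first letter: [a], [b], [c], or a sum of two or
    three of them.  The terms starting with [a] on the left, and those starting
    with [c] on the right, come split in three by the recursion, and are
    regrouped before the induction hypotheses apply. *)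
Lemma stuffleA x y z : stuffle x (stuffle y z) = stuffle (stuffle x y) z.
Proof.
elim/words_ind: x => [u|c x IH|x1 x2 IH1 IH2]; last 2 first.
- by rewrite !bilinZ IH.
- by rewrite !bilinD IH1 IH2.
elim/words_ind: y => [v|c y IH|y1 y2 IH1 IH2]; last 2 first.
- by rewrite !bilinZ IH.
- by rewrite !bilinD IH1 IH2.
elim/words_ind: z => [w|c z IH|z1 z2 IH1 IH2]; last 2 first.
- by rewrite !bilinZ IH.
- by rewrite !bilinD IH1 IH2.
elim: u v w => [|a u IHu] v w; first by rewrite !stuffle_nil_l.
elim: v w => [|b v IHv] w; first by rewrite stuffle_nil_l stuffle_nil_r.
elim: w => [|c w IHw]; first by rewrite !stuffle_nil_r.
have HA := congr1 (prepend a) (IHu (b :: v) (c :: w)).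
have HC := congr1 (prepend c) IHw.
rewrite !stuffle_cons !bilinD -!prepend_word !stuffle_prepend !prepend_word.
rewrite stuffle_cons !bilinD in HA; rewrite [in RHS]stuffle_cons !bilinD in HC.
(* Positions 1, 4, 7 are the pieces of the a-term; on the other side 2, 5, 8
   are those of the c-term. *)
rewrite [LHS](AC (3*3*3) ((1*4*7)*2*3*5*6*8*9)) /= HA.
rewrite [RHS](AC (3*3*3) (1*4*7*(2*5*8)*3*6*9)) /= -HC.
by rewrite !IHv !IHu addnA.
Qed.

(** * Existence of the decomposition along powers of (1) *)

Lemma stuffle0l x : stuffle 0 x = 0.
Proof. exact: fglift0. Qed.

Lemma all_dom0 (p : pred (seq nat)) : all p (dom (0 : words)).
Proof. by rewrite dom0. Qed.

Lemma all_domD (p : pred (seq nat)) (x y : words) :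
  all p (dom x) -> all p (dom y) -> all p (dom (x + y)).
Proof.
move=> px py; apply/allP => w /domD_subset.
by rewrite mem_cat => /orP[] ?; [apply: (allP px) | apply: (allP py)].
Qed.

Lemma all_domZ (p : pred (seq nat)) c (x : words) :
  all p (dom x) -> all p (dom (c *: x)).
Proof. by move=> px; apply/allP => w /domZ_subset; apply: (allP px). Qed.

(** The notion of [is_stuffle_decomp] for an arbitrary element and a bound [r]
    on the depth, which makes it stable under linear combinations. *)
Definition decomposable (r : nat) (x : words) :=
  exists2 U : nat -> words,
    forall l, (l <= r)%N -> in_H0 (U l) /\ depth_le (r - l) (U l) &
    x = \sum_(l < r.+1) stuffle (U l) (stuffle_exp << [:: 1%N] >> l).

Lemma decomposable0 r : decomposable r 0.
Proof.
exists (fun=> 0) => [l _|]; first by split; exact: all_dom0.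
by rewrite big1 // => l _; rewrite stuffle0l.
Qed.

Lemma decomposableD r x y :
  decomposable r x -> decomposable r y -> decomposable r (x + y).
Proof.
move=> [U HU ->] [V HV ->]; exists (fun l => U l + V l) => [l lr|].
  have [U1 U2] := HU l lr; have [V1 V2] := HV l lr.
  by split; apply: all_domD.
by rewrite -big_split /=; apply: eq_bigr => l _; rewrite stuffleDl.
Qed.

Lemma decomposableZ r c x : decomposable r x -> decomposable r (c *: x).
Proof.
move=> [U HU ->]; exists (fun l => c *: U l) => [l lr|].
  by have [U1 U2] := HU l lr; split; apply: all_domZ.
by rewrite scaler_sumr; apply: eq_bigr => l _; rewrite stuffleZl.
Qed.

Lemma decomposable_sum r (I : eqType) (s : seq I) (F : I -> words) :
  {in s, forall i, decomposable r (F i)} -> decomposable r (\sum_(i <- s) F i).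
Proof.
move=> HF; rewrite big_seq; apply: (big_ind (decomposable r)) => //.
  exact: decomposable0.
exact: decomposableD.
Qed.

(** Multiplying by (1) shifts the coefficients: associativity and
    commutativity move the new factor next to the power of (1). *)
Lemma decomposable_stuffle1 r x :
  decomposable r x -> decomposable r.+1 (stuffle << [:: 1%N] >> x).
Proof.
move=> [U HU ->]; exists (fun l => if l is l'.+1 then U l' else 0) => [[|l] lr|].
- by split; exact: all_dom0.
- by rewrite subSS; exact: HU.
rewrite [RHS]big_ord_recl /= stuffle0l add0r linear_sum /=.
apply: eq_bigr => l _; rewrite /= -/(stuffle_exp _ l).
by rewrite stuffleA (stuffleC << _ >>) -stuffleA.
Qed.

Lemma decomposable_admissible r k :
  admissible k -> (size k <= r)%N -> decomposable r << k >>.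
Proof.
move=> ak kr; exists (fun l => if l is 0%N then << k >> else 0) => [[|l] lr|].
- by rewrite /in_H0 /depth_le domU1 /= ak subn0 kr.
- by split; exact: all_dom0.
rewrite big_ord_recl /= stuffle_nil_r big1 ?addr0 // => l _.
by rewrite stuffle0l.
Qed.

(** An index is admissible exactly when this number vanishes; it is the
    induction parameter for the existence of decompositions. *)
Definition trailing_ones (w : seq nat) : nat := find (predC1 1%N) (rev w).

Lemma trailing_ones_split p c q :
  trailing_ones (p ++ c :: q) =
    if all (pred1 1%N) q
    then (if c == 1%N then (size q + (trailing_ones p).+1)%N else size q)
    else trailing_ones q.
Proof.
rewrite /trailing_ones rev_cat rev_cons cat_rcons find_cat has_rev has_predC /=.
by rewrite size_rev; case: all => //=; case: eqP => //=; rewrite addn0.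
Qed.

(** The stuffle product with (1) either inserts a new letter 1 or increases an
    existing letter by one. *)
Lemma mem_stuffle_words1 v w : w \in stuffle_words [:: 1%N] v ->
  (exists p q, v = p ++ q /\ w = p ++ 1%N :: q) \/
  (exists p b q, v = p ++ b :: q /\ w = p ++ b.+1 :: q).
Proof.
elim: v w => [|b v IH] w /=; first by rewrite inE => /eqP ->; left; exists [::], [::].
rewrite inE => /orP[/eqP ->|]; first by left; exists [::], (b :: v); case: (v).
rewrite mem_cat => /orP[/mapP[w' /IH + ->]|].
  case=> [[p [q [-> ->]]]|[p [c [q [-> ->]]]]].
    by left; exists (b :: p), q.
  by right; exists (b :: p), c, q.
by case: v {IH} => [|c v] /=; rewrite inE => /eqP ->; right; eexists [::], b, _.
Qed.

Lemma rcons_mem_stuffle_words1 v : rcons v 1%N \in stuffle_words [:: 1%N] v.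
Proof.
elim: v => [|b v IH]; first by rewrite inE.
by rewrite /= inE mem_cat map_f ?orbT.
Qed.

(** If the letter 1 is inserted inside the final block of ones, or right before
    it, the result is [v] followed by 1; in every other case the final block
    does not grow. *)
Lemma stuffle_words1_smaller v w : is_index v -> w \in stuffle_words [:: 1%N] v ->
  [/\ is_index w, (size w <= (size v).+1)%N &
      w = rcons v 1%N \/ (trailing_ones w <= trailing_ones v)%N].
Proof.
rewrite /is_index => iv /mem_stuffle_words1[[p [q [ev ew]]]|[p [b [q [ev ew]]]]].
  rewrite ew ev in iv *; move: iv; rewrite !all_cat /= => /andP[-> ->].
  rewrite !size_cat addnS; split=> //.
  case: (boolP (all (pred1 1%N) q)) => q1.
    left; rewrite rcons_cat; congr (_ ++ _).
    by move/all_pred1P: q1 => ->; elim: (size q) => //= n {1}->.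
  right; rewrite trailing_ones_split (negPf q1).
  rewrite /trailing_ones rev_cat find_cat has_rev has_predC q1.
  done.
rewrite ew ev in iv *; move: iv; rewrite !all_cat /= => /and3P[-> b0 ->].
rewrite !size_cat /=; split=> //; right.
rewrite !trailing_ones_split; case: all => //.
by case: b b0 {ev ew} => // b _ /=; case: ifP => // _; rewrite leq_addr.
Qed.

(** Induction on the number of trailing ones.  If the index is [v] followed by
    1, then (1) * v is a positive multiple of it plus words with strictly fewer
    trailing ones, so that it can be solved for, over the rationals. *)
Lemma index_decomposable r k :
  is_index k -> (size k <= r)%N -> decomposable r << k >>.
Proof.
have [n] := ubnP (trailing_ones k); elim: n k r => // n IH k r kn ik kr.
have [ak|nak] := boolP (admissible k); first exact: decomposable_admissible.
case/lastP: k kn ik kr nak => // v c kn ik kr.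
rewrite /admissible ik last_rcons /= -leqNgt => c1.
have {c1} ec : c = 1%N.
  by apply/eqP; rewrite eqn_leq c1; move: ik; rewrite /is_index all_rcons => /andP[].
have iv : is_index v by move: ik; rewrite /is_index all_rcons => /andP[].
rewrite ec in kn kr *; move: kn kr; rewrite size_rcons -cats1 trailing_ones_split /=.
rewrite cats1 ltnS => vn; case: r => // r vr.
set m := count_mem (rcons v 1%N) (stuffle_words [:: 1%N] v).
have m0 : m%:R != 0 :> rat.
  by rewrite pnatr_eq0 -lt0n -has_count has_pred1 rcons_mem_stuffle_words1.
have E : stuffle << [:: 1%N] >> << v >> = m%:R *: << rcons v 1%N >> 
   + \sum_(w <- stuffle_words [:: 1%N] v | w != rcons v 1%N) << w >>.
  rewrite stuffle_word (bigID (pred1 (rcons v 1%N))) /=; congr (_ + _).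
  rewrite (eq_bigr (fun=> << rcons v 1%N >>)); last by move=> w /eqP ->.
  by rewrite big_const_seq iter_addr_0 scaler_nat.
have -> : << rcons v 1%N >> = m%:R^-1 *: (stuffle << [:: 1%N] >> << v >> +
    (-1) *: \sum_(w <- [seq w <- stuffle_words [:: 1%N] v | w != rcons v 1%N])
      << w >>) :> words.
  by rewrite E big_filter scaleN1r addrK scalerA mulVf // scale1r.
apply/decomposableZ/decomposableD.
  by apply/decomposable_stuffle1/IH.
apply/decomposableZ/decomposable_sum => w.
rewrite mem_filter => /andP[wv /(stuffle_words1_smaller iv)[iw sw]].
case=> [ew|tw]; first by rewrite ew eqxx in wv.
apply: IH => //; first exact: leq_ltn_trans tw _.
by apply: leq_trans sw _.
Qed.

Lemma stuffle_decompP k : is_index k -> is_stuffle_decomp (stuffle_decomp k).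
Proof.
move=> ik; rewrite /stuffle_decomp; case: xgetP => [u -> //|nodecomp].
have [U HU EU] := index_decomposable ik (leqnn _).
case: (nodecomp [ffun l => U (val l)]); split => [l|].
  by rewrite ffunE; apply: HU; rewrite -ltnS ltn_ord.
by rewrite EU; apply: eq_bigr => l _; rewrite ffunE.
Qed.

(** * Truncated sums as monomial quasi-symmetric functions *)

Section Monomial.
Variable F : comNzRingType.
Implicit Types (xs : seq F) (u v : seq nat).

(** The monomial quasi-symmetric function of exponents [u] at the points [xs]:
    the sum of x_1^{u_1} ... x_r^{u_r} over the subsequences of [xs].  The
    recursion is on the list of points, according to whether the first one is
    used. *)
Fixpoint qsym xs u : F :=
  match u, xs with
  | [::], _ => 1
  | _ :: _, [::] => 0
  | a :: u', x :: xs' => qsym xs' u + x ^+ a * qsym xs' u'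
  end.

Lemma qsym_nil xs : qsym xs [::] = 1.
Proof. by case: xs. Qed.

(** The recursion on the last point, which isolates the last and largest
    summation index: it controls the tails of the sums. *)
Lemma qsym_rcons xs x u a :
  qsym (rcons xs x) (rcons u a) = qsym xs (rcons u a) + x ^+ a * qsym xs u.
Proof.
elim: xs u => [|y xs IH] [|b u] //=; rewrite ?qsym_nil ?mulr0 ?mulr1 //.
- by rewrite !add0r; case: u => [|c u] /=; rewrite ?mulr0.
- by move: (IH [::]) => /= ->; rewrite !qsym_nil mulr1 addrAC.
rewrite -!rcons_cons !IH mulrDr [in RHS]mulrDr mulrCA !addrA; congr (_ + _).
by rewrite addrAC.
Qed.

(** When a point is added in front, its contribution to the product goes to
    the first letter of the left word, of the right word, or of both: these are
    the three cases of the stuffle recursion.  Hence an induction on the list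
    of points suffices, with no induction on the words. *)
Lemma qsym_stuffle xs u v :
  qsym xs u * qsym xs v = \sum_(w <- stuffle_words u v) qsym xs w.
Proof.
elim: xs u v => [|x xs IH] [|a u] [|b v]; rewrite ?qsym_nil ?mul1r ?mulr1 /= ?big_seq1 //.
  rewrite mul0r big1_seq // => w /andP[_].
  by rewrite !mem_cat => /or3P[] /mapP[w' _ ->].
have := IH (a :: u) (b :: v); rewrite /= !big_cat !big_map /= => Eab.
have S s c : \sum_(w <- s) (qsym xs (c :: w) + x ^+ c * qsym xs w) =
   \sum_(w <- s) qsym xs (c :: w) + x ^+ c * \sum_(w <- s) qsym xs w.
  by rewrite big_split mulr_sumr.
rewrite -/(stuffle_words (a :: u) v) !S -!IH exprD.
rewrite mulrDl !mulrDr Eab -/(stuffle_words (a :: u) v).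
ring.
Qed.
End Monomial.

Section Evaluation.
Variable F : numFieldType.
Implicit Types (f : seq nat -> F) (u v : words).

(** [zeta_lin] is the instance in which [f] is the zeta function. *)
Definition lin_eval f u : F := \sum_(a <- dom u) ratr (coeff a u) * f a.

Lemma lin_eval_superset f u s : uniq s -> {subset dom u <= s} ->
  lin_eval f u = \sum_(a <- s) ratr (coeff a u) * f a.
Proof.
move=> us sub; rewrite (bigID (mem (dom u))) /= -[in RHS]big_filter.
rewrite [X in _ + X]big1 ?addr0; last first.
  by move=> a /coeff_outdom ->; rewrite rmorph0 mul0r.
apply: perm_big; apply: uniq_perm; rewrite ?filter_uniq ?uniq_dom //.
by move=> a; rewrite mem_filter andb_idr //; apply: sub.
Qed.

Lemma lin_eval_word f w : lin_eval f << w >> = f w.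
Proof. by rewrite /lin_eval domU1 big_seq1 coeffU eqxx mulr1 rmorph1 mul1r. Qed.

Lemma lin_evalD f u v : lin_eval f (u + v) = lin_eval f u + lin_eval f v.
Proof.
pose s := undup (dom u ++ dom v).
have sub w : w \in dom u ++ dom v -> w \in s by rewrite mem_undup.
have us : uniq s by apply: undup_uniq.
rewrite !(lin_eval_superset f us) -?big_split /=.
- by apply: eq_bigr => a _; rewrite coeffD rmorphD mulrDl.
- by move=> w wv; apply: sub; rewrite mem_cat wv orbT.
- by move=> w wv; apply: sub; rewrite mem_cat wv.
by move=> w /domD_subset /sub.
Qed.

Lemma lin_evalZ f c u : lin_eval f (c *: u) = ratr c * lin_eval f u.
Proof.
rewrite (lin_eval_superset f (uniq_dom u)); last exact: domZ_subset.
by rewrite mulr_sumr; apply: eq_bigr => a _; rewrite coeffZ rmorphM mulrA.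
Qed.

Lemma lin_eval_sum f (I : Type) (s : seq I) (G : I -> words) :
  lin_eval f (\sum_(i <- s) G i) = \sum_(i <- s) lin_eval f (G i).
Proof.
apply: big_morph => [u v|]; first exact: lin_evalD.
by rewrite -(scale0r 0) lin_evalZ rmorph0 mul0r.
Qed.

Lemma lin_eval_stuffle f : f [::] = 1 ->
  (forall u v : seq nat, f u * f v = \sum_(w <- stuffle_words u v) f w) ->
  forall x y, lin_eval f (stuffle x y) = lin_eval f x * lin_eval f y.
Proof.
move=> f1 fM x y.
elim/words_ind: x => [u|c x IH|x1 x2 IH1 IH2]; last 2 first.
- by rewrite stuffleZl !lin_evalZ IH mulrA.
- by rewrite stuffleDl !lin_evalD IH1 IH2 mulrDl.
elim/words_ind: y => [v|c y IH|y1 y2 IH1 IH2]; last 2 first.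
- by rewrite stuffleZr !lin_evalZ IH mulrCA.
- by rewrite stuffleDr !lin_evalD IH1 IH2 mulrDr.
rewrite stuffle_word lin_eval_sum !lin_eval_word fM.
by apply: eq_bigr => w _; rewrite lin_eval_word.
Qed.

(** A multiplicative [f] sends the decomposition of an index to a polynomial
    in [f (1)].  This is the exact form of the asymptotic expansion, before
    passing to the limit in the coefficients. *)
Lemma lin_eval_decomp f (f1 : f [::] = 1)
  (fM : forall u v : seq nat, f u * f v = \sum_(w <- stuffle_words u v) f w) k :
  is_index k ->
  f k = \sum_(l < (size k).+1) lin_eval f (stuffle_decomp k l) * f [:: 1%N] ^+ l.
Proof.
move=> /stuffle_decompP[_ E]; rewrite -(lin_eval_word f k) {1}E lin_eval_sum.
apply: eq_bigr => l _; rewrite (lin_eval_stuffle f1 fM); congr (_ * _).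
elim: (val l) => [|n IH]; first by rewrite lin_eval_word f1.
rewrite /stuffle_exp iterS (lin_eval_stuffle f1 fM) -/(stuffle_exp _ _) IH.
by rewrite lin_eval_word exprS.
Qed.
End Evaluation.

Section Trunc.
Variable R : realType.
Implicit Types (s : R[i]) (k : seq nat).

Definition shifted_inverses N s := [seq (n%:R + s)^-1 | n <- iota 1 N.-1].

(** Truncated sums whose indices exceed [m], so that summing over the first
    index leaves a sum of the same kind. *)
Definition zeta_from N s m k : R[i] :=
  \sum_(n : (size k).-tuple 'I_N | path ltn m (map val n))
    \prod_(i < size k) ((val (tnth n i))%:R + s) ^- nth 0%N k i.

Lemma big_tuple_cons (V : nmodType) (T : finType) (d : nat)
    (P : pred (d.+1.-tuple T)) (G : d.+1.-tuple T -> V) :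
  \sum_(t | P t) G t =
    \sum_(x : T) \sum_(t : d.-tuple T | P (cons_tuple x t)) G (cons_tuple x t).
Proof.
rewrite pair_big_dep /= (reindex (fun p : T * d.-tuple T => cons_tuple p.1 p.2)) //=.
exists (fun t => (thead t, behead_tuple t)) => [[x t] _|t _] /=.
  by congr pair; apply: val_inj.
by rewrite [t]tuple_eta; apply: val_inj.
Qed.

Lemma zeta_from_nil N s m : zeta_from N s m [::] = 1.
Proof.
rewrite /zeta_from (eq_bigl (pred1 [tuple])).
  by rewrite big_pred1_eq big_ord0.
by move=> t; rewrite (tuple0 t) /= eqxx.
Qed.

Lemma zeta_from_cons N s m a k :
  zeta_from N s m (a :: k) =
  \sum_(m.+1 <= n < N) (n%:R + s) ^- a * zeta_from N s n k.
Proof.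
rewrite /zeta_from /= big_tuple_cons big_geq_mkord [RHS]big_mkcond /=.
apply: eq_bigr => x _; case: ifP => mx; last by rewrite big_pred0 // => t; rewrite /= mx.
rewrite mulr_sumr; apply: eq_big => [t|t _]; first by [].
rewrite big_ord_recl /= tnth0; congr (_ * _).
by apply: eq_bigr => i _; rewrite tnthS.
Qed.

Lemma zeta_from_qsym N s m k :
  zeta_from N s m k = qsym [seq (n%:R + s)^-1 | n <- iota m.+1 (N - m.+1)] k.
Proof.
elim: k m => [|a k IH] m; first by rewrite zeta_from_nil qsym_nil.
rewrite zeta_from_cons; under eq_bigr do rewrite IH -exprVn.
have [d] := ubnP (N - m.+1); elim: d m => // d IHd m.
rewrite ltnS => dm; have [Nm|mN] := leqP N m.+1.
  by rewrite big_geq // (eqP Nm).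
rewrite -(subnSK mN) in dm *.
by rewrite big_ltn // IHd //= addrC.
Qed.

Lemma zeta_truncE N s k :
  zeta_trunc N k s = qsym (shifted_inverses N s) k.
Proof. by rewrite /shifted_inverses -subn1 -zeta_from_qsym. Qed.
End Trunc.

(** * Sums with logarithmic weights *)

Section RealBounds.
Variable R : realType.

Definition succ_ln (N : nat) : R := 1 + ln N%:R.
Local Notation L := succ_ln.

Lemma succ_ln_ge1 N : 1 <= L N.
Proof.
rewrite /L lerDl; case: N => [|N]; first by rewrite ln0.
by rewrite ln_ge0 // ler1n.
Qed.

Lemma succ_ln_gt0 N : 0 < L N.
Proof. exact: lt_le_trans ltr01 (succ_ln_ge1 N). Qed.

Lemma succ_ln_le n m : (n <= m)%N -> L n <= L m.
Proof.
case: n => [|n] nm; first by rewrite {1}/L ln0 // addr0 succ_ln_ge1.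
rewrite /L lerD2l ler_ln ?posrE ?ltr0n ?ler_nat //.
exact: leq_trans nm.
Qed.

(** The sum up to n is at most 1 + ln n because 1 / (n + 1) is at most
    - ln (1 - 1 / (n + 1)) = ln (n + 1) - ln n. *)
Lemma harmonic_le_succ_ln N : \sum_(1 <= n < N) n%:R^-1 <= L N.
Proof.
case: N => [|[|m]]; [by rewrite big_geq ?ltW ?succ_ln_gt0..|].
suff H : \sum_(1 <= n < m.+2) n%:R^-1 <= L m.+1 by apply: (le_trans H); apply: succ_ln_le.
elim: m => [|m IH]; first by rewrite big_nat1 invr1 succ_ln_ge1.
rewrite big_nat_recr //= (le_trans (lerD IH (lexx _))) // /L -addrA lerD2l.
have m1 : 0 < m.+1%:R :> R by rewrite ltr0n.
have m2 : 0 < m.+2%:R :> R by rewrite ltr0n.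
have e : 1 + - m.+2%:R^-1 = m.+1%:R / m.+2%:R :> R.
  apply: (canRL (mulfK (lt0r_neq0 m2))).
  by rewrite mulrBl mul1r mulVf ?lt0r_neq0 // -natr1 addrK.
have /le_ln1Dx : -1 < - m.+2%:R^-1 :> R by rewrite ltrN2 invf_lt1 // ltr1n.
by rewrite e ln_div // lerBlDr [_ + ln _]addrC lerBrDr.
Qed.

(** From 1 + x <= exp x at x = t / 2q, raised to the power q; taking q = p + 1
    instead of p keeps the exponent positive. *)
Lemma powerD1_le_expR p :
  exists2 C : R, 0 <= C & forall t, 0 <= t -> (1 + t) ^+ p <= C * expR (t / 2).
Proof.
pose q := p.+1; have q0 : 0 < q%:R :> R by rewrite ltr0n.
exists ((2 * q%:R) ^+ q) => [|t t0]; first by rewrite exprn_ge0 // mulr_ge0 // ltW.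
have -> : t / 2 = t / (2 * q%:R) * q%:R by field; rewrite gt_eqF.
rewrite expRM_natr -exprMn; apply: (@le_trans _ _ ((1 + t) ^+ q)).
  by rewrite ler_weXn2l ?lerDl.
rewrite lerXn2r ?nnegrE ?addr_ge0 ?mulr_ge0 ?expR_ge0 //.
apply: (@le_trans _ _ (2 * q%:R * (1 + t / (2 * q%:R)))); last first.
  by rewrite ler_pM2l ?expR_ge1Dx // mulr_gt0.
have -> : 2 * q%:R * (1 + t / (2 * q%:R)) = 2 * q%:R + t by field; rewrite gt_eqF.
have : 1 <= q%:R :> R by rewrite ler1n.
lra.
Qed.

(** 1 + a + b <= (1 + a) (1 + b) for nonnegative a and b. *)
Lemma succ_ln_submul n m : (0 < n <= m)%N -> L m <= L n * (1 + ln (m%:R / n%:R)).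
Proof.
move=> /andP[n0 nm].
have n0' : 0 < n%:R :> R by rewrite ltr0n.
have m0' : 0 < m%:R :> R by rewrite ltr0n (leq_trans n0).
have -> : L m = L n + ln (m%:R / n%:R) by rewrite /L ln_div // -addrA subrKC.
rewrite mulrDr mulr1 lerD2l ler_peMl ?succ_ln_ge1 // ln_ge0 //.
by rewrite ler_pdivlMr // mul1r ler_nat.
Qed.

Lemma expR_half_ln (x : R) : 0 < x -> expR (ln x / 2) = Num.sqrt x.
Proof.
move=> x0; apply/eqP; rewrite -(@eqrXn2 _ 2) ?expR_ge0 ?sqrtr_ge0 //.
by rewrite sqr_sqrtr ?ltW // -expRM_natr mulfVK // lnK.
Qed.

(** Logarithmic growth beyond [n] costs less than a square root of the ratio.
    This is what allows the weight of a tail sum to be frozen at its first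
    index. *)
Lemma succ_ln_pow_sqrt p : exists2 C : R, 0 <= C &
  forall n m, (0 < n <= m)%N ->
    L m ^+ p <= C * L n ^+ p * (Num.sqrt m%:R / Num.sqrt n%:R).
Proof.
have [C C0 HC] := powerD1_le_expR p; exists C => // n m /[dup] nm /andP[n0 lnm].
have n0' : 0 < n%:R :> R by rewrite ltr0n.
have m0' : 0 < m%:R :> R by rewrite ltr0n (leq_trans n0).
have mn1 : 1 <= m%:R / n%:R :> R by rewrite ler_pdivlMr // mul1r ler_nat.
apply: (@le_trans _ _ ((L n * (1 + ln (m%:R / n%:R))) ^+ p)).
  have H : 0 <= 1 + ln (m%:R / n%:R) :> R by rewrite addr_ge0 // ln_ge0.
  rewrite lerXn2r ?nnegrE ?succ_ln_submul ?(ltW (succ_ln_gt0 _)) //.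
  by rewrite mulr_ge0 // ltW // succ_ln_gt0.
rewrite exprMn [C * _]mulrC -mulrA ler_wpM2l ?exprn_ge0 ?(ltW (succ_ln_gt0 _)) //.
rewrite -sqrtrV ?ler0n // -sqrtrM ?ler0n // -expR_half_ln ?divr_gt0 //.
by apply: HC; rewrite ln_ge0.
Qed.

(** The terms n^{-3/2} are dominated by the increments of -6 / sqrt n: with
    a = sqrt n and b = sqrt (n + 1), the difference 1 / a - 1 / b equals
    1 / (a b (a + b)), and b <= 2 a. *)
Lemma sqrt_telescope (n : nat) : (0 < n)%N ->
  Num.sqrt n%:R / n%:R ^+ 2 <= 6 * ((Num.sqrt n%:R)^-1 - (Num.sqrt n.+1%:R)^-1) :> R.
Proof.
move=> n0; set a := Num.sqrt n%:R; set b := Num.sqrt n.+1%:R.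
have a2 : n%:R = a ^+ 2 :> R by rewrite sqr_sqrtr.
have b2 : b ^+ 2 = a ^+ 2 + 1 by rewrite -a2 sqr_sqrtr // -natr1.
have a1 : 1 <= a by rewrite -[1]sqrtr1 ler_sqrt // ler1n.
have b0 : 0 < b by rewrite sqrtr_gt0 ltr0n.
have b2a : b <= 2 * a.
  by rewrite -(@ler_pXn2r _ 2) // ?nnegrE; nra.
have a0 : 0 < a by lra.
rewrite a2.
have -> : a / (a ^+ 2) ^+ 2 = (a ^+ 3)^-1 by field; rewrite gt_eqF.
have -> : a^-1 - b^-1 = (a * b * (a + b))^-1.
  have -> : a^-1 - b^-1 = (b ^+ 2 - a ^+ 2) / (a * b * (a + b)).
    by field; rewrite !gt_eqF ?addr_gt0.
  by rewrite b2 addrC addKr mul1r.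
have D : 0 < a * b * (a + b) by rewrite !mulr_gt0 ?addr_gt0.
rewrite ler_pdivlMr // mulrC ler_pdivrMr ?exprn_gt0 //.
have : a * b * (a + b) <= a * (2 * a) * (a + 2 * a).
  by apply: ler_pM; rewrite ?ler_wpM2l ?mulr_ge0 ?addr_ge0 ?lerD2l // ltW.
rewrite !exprS expr0; nra.
Qed.

(** Freezing the logarithm at [n] leaves a tail of the series of i^{-3/2},
    which telescopes to a multiple of n^{-1/2}; the other factor n^{-1/2} comes
    from the normalization of the square root. *)
Lemma succ_ln_tail p : exists2 C : R, 0 <= C &
  forall n m, (0 < n)%N ->
    \sum_(n <= i < m) L i ^+ p / i%:R ^+ 2 <= C * (L n ^+ p / n%:R).
Proof.
have [C C0 HC] := succ_ln_pow_sqrt p; exists (6 * C); first by rewrite mulr_ge0.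
move=> n m n0.
pose g i : R := (Num.sqrt i%:R)^-1.
have [mn|nm] := leqP m n.
  by rewrite big_geq // mulr_ge0 // mulr_ge0 ?invr_ge0 // exprn_ge0 // ltW // succ_ln_gt0.
set D := C * L n ^+ p / Num.sqrt n%:R.
have D0 : 0 <= D.
  by rewrite mulr_ge0 ?invr_ge0 ?sqrtr_ge0 // mulr_ge0 // exprn_ge0 // ltW // succ_ln_gt0.
apply: (@le_trans _ _ (\sum_(n <= i < m) - (D * 6) * (g i.+1 - g i))).
  rewrite !big_nat ler_sum // => i /andP[ni im].
  have i0 : (0 < i)%N by exact: leq_trans ni.
  have := sqrt_telescope i0; rewrite -/(g i) -/(g i.+1) => st.
  rewrite mulNr -mulrN opprB -mulrA (le_trans _ (ler_wpM2l D0 st)) // mulrA.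
  rewrite ler_wpM2r ?invr_ge0 ?exprn_ge0 //.
  by rewrite (le_trans (HC n i _)) ?n0 ?ni // /D -!mulrA [(_^-1 * _)]mulrC.
rewrite -mulr_sumr telescope_sumr ?(ltnW nm) // mulNr -mulrN opprB.
apply: (@le_trans _ _ (D * 6 * g n)).
  by rewrite ler_wpM2l ?(mulr_ge0 D0) // gerBl invr_ge0 sqrtr_ge0.
rewrite le_eqVlt; apply/orP; left; apply/eqP; rewrite /D /g.
have n0' : 0 < n%:R :> R by rewrite ltr0n.
set q := Num.sqrt n%:R.
have -> : n%:R^-1 = q^-1 * q^-1 by rewrite -invfM -expr2 sqr_sqrtr ?ler0n.
by ring.
Qed.

Lemma succ_ln_pow_small p (e : R) : 0 < e ->
  exists2 n : nat, (0 < n)%N & L n ^+ p / n%:R <= e.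
Proof.
move=> e0; have [C C0 HC] := succ_ln_pow_sqrt p.
pose n := (Num.bound (C / e) ^ 2).+1.
exists n => //.
have n0' : 0 < n%:R :> R by rewrite ltr0n.
have s0 : 0 < Num.sqrt n%:R :> R by rewrite sqrtr_gt0.
have := HC 1%N n isT; rewrite /L ln1 addr0 expr1n sqrtr1 divr1 mulr1 => H.
rewrite ler_pdivrMr // (le_trans H) // -{2}(sqr_sqrtr (ltW n0')) expr2 mulrA ler_pM2r //.
rewrite -ler_pdivrMl // mulrC.
have : C / e < (Num.bound (C / e))%:R by rewrite archi_boundP ?divr_ge0 // ltW.
move=> /ltW /le_trans; apply.
rewrite -[X in X <= _]ger0_norm // -sqrtr_sqr ler_sqrt // -natrX ler_nat.
exact: leqnSn.
Qed.
End RealBounds.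

(** * Limits of complex sequences with a Cauchy rate *)

Section Limits.
Variable R : realType.

Definition arbitrarily_small (B : nat -> R) :=
  forall e, 0 < e -> exists2 n, (0 < n)%N & B n <= e.

Lemma real_limit_dist (v : nat -> R) B :
  (forall n m, (0 < n <= m)%N -> `|v m - v n| <= B n) -> arbitrarily_small B ->
  exists l, forall n, (0 < n)%N -> `|l - v n| <= B n.
Proof.
move=> vB B0.
have /cauchy_cvgP cv : cauchy (v @ \oo).
  apply: cauchy_exP => e e0; have [n n0 Bn] := B0 _ (divr_gt0 e0 (ltr0n R 2)).
  exists (v n); exists n => // m /= nm; rewrite -ball_normE /= distrC.
  apply: le_lt_trans (vB n m _) _; first by rewrite n0.
  by apply: le_lt_trans Bn _; rewrite ltr_pdivrMr // mulr_natr mulr2n ltrDl.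
exists (lim (v @ \oo)) => n n0; apply/ler_addgt0Pr => e e0.
have /cvgrPdist_le/(_ e e0)[m _ Hm] := cv.
have := Hm (maxn m n) (leq_maxl _ _) => /= H.
rewrite -(subrK (v (maxn m n)) (lim _)) -addrA addrC (le_trans (ler_normD _ _)) //.
by rewrite lerD // vB // n0 leq_maxr.
Qed.

Lemma norm_real_complex (x : R) : `|x%:C| = `|x|%:C :> R[i].
Proof. by rewrite normc_def /= expr0n addr0 sqrtr_sqr. Qed.

Lemma norm_complexi : `|'i%C| = 1 :> R[i].
Proof. by rewrite normc_def /= expr0n expr1n add0r sqrtr1. Qed.

Lemma norm_Im_le (z : R[i]) : `|complex.Im z|%:C <= `|z|.
Proof.
by rewrite -normrN -ReiNIm (le_trans (normc_ge_Re _)) // normrM norm_complexi mulr1.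
Qed.

Lemma normc_le_ReIm (z : R[i]) : `|z| <= (`|complex.Re z| + `|complex.Im z|)%:C.
Proof.
rewrite {1}[z]complexE (le_trans (ler_normD _ _)) // normrM norm_complexi mul1r.
by rewrite !norm_real_complex rmorphD.
Qed.

(** The limit is built from those of the real and imaginary parts, which only
    give the rate 2 B; letting the larger index tend to infinity in the
    hypothesis then restores the constant. *)
Lemma complex_limit_dist (u : nat -> R[i]) B :
  (forall n m, (0 < n <= m)%N -> `|u m - u n| <= (B n)%:C) ->
  arbitrarily_small B ->
  forall n, (0 < n)%N -> `|lim ((fun N => u N : R[i]^o) @ \oo) - u n| <= (B n)%:C.
Proof.
move=> uB B0.
have [a Ha] : exists a, forall n, (0 < n)%N -> `|a - complex.Re (u n)| <= B n.
  apply: real_limit_dist B0 => n m nm; rewrite -lecR; apply: le_trans (uB n m nm).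
  by rewrite (le_trans _ (normc_ge_Re _)) // lecR raddfB.
have [b Hb] : exists b, forall n, (0 < n)%N -> `|b - complex.Im (u n)| <= B n.
  apply: real_limit_dist B0 => n m nm; rewrite -lecR; apply: le_trans (uB n m nm).
  by rewrite (le_trans _ (norm_Im_le _)) // lecR raddfB.
have Hl n : (0 < n)%N -> `|a +i* b - u n| <= (2 * B n)%:C.
  move=> n0; apply: le_trans (normc_le_ReIm _) _; rewrite lecR mulr_natl mulr2n.
  by move: (Ha n n0) (Hb n n0); case: (u n) => x y /= Hx Hy; apply: lerD.
have cl : (fun N => u N : R[i]^o) @ \oo --> (a +i* b : R[i]^o).
  apply/cvgrPdist_le => e e0.
  have e1 : (complex.Re e)%:C = e by apply: RRe_real; exact: gtr0_real.
  have e2 : 0 < complex.Re e / 3 by rewrite divr_gt0 // -ltcR e1.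
  have [n n0 Bn] := B0 _ e2; exists n => // m /= nm.
  rewrite -(subrK (u n) (a +i* b)) -addrA (le_trans (ler_normD _ _)) //.
  rewrite [`|u n - _|]distrC (le_trans (lerD (Hl n n0) (uB n m _))) ?n0 //.
  by rewrite -e1 -rmorphD lecR; lra.
move=> n n0; rewrite (cvg_lim _ cl); last exact: norm_hausdorff.
apply/ler_addgt0Pr => e e0.
have /cvgrPdist_le/(_ e e0)[m _ Hm] := cl.
have := Hm (maxn m n) (leq_maxl _ _) => /= H.
rewrite -(subrK (u (maxn m n)) (a +i* b)) -addrA addrC (le_trans (ler_normD _ _)) //.
by rewrite lerD // uB // n0 leq_maxr.
Qed.

(** The condition that the norm is at most [n] holds, for large [n], on a unit
    ball around each point, hence by compactness on [K] for some common [n]. *)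
Lemma compact_normc_bounded (K : set R[i]^o) : compact K ->
  exists2 M : R, 0 <= M & forall s : R[i], K s -> `|s| <= M%:C.
Proof.
move=> /compact_near_coveringP/(_ nat \oo (fun n (s : R[i]) => `|s| <= n%:R)) [].
  move=> s _; have e1 : (complex.Re `|s|)%:C = `|s| by apply: RRe_real; exact: normr_real.
  set M := Num.bound (1 + complex.Re `|s|).
  exists ([set y | `|y| <= M%:R], [set n | (M <= n)%N]) => /=.
    split; last by exists M.
    apply/nbhs_ballP; exists 1 => //= y; rewrite -ball_normE /= => sy.
    rewrite -(subrK s y) (le_trans (ler_normD _ _)) //.
    rewrite distrC (le_trans (lerD (ltW sy) (lexx _))) // -e1.
    have -> : M%:R = (M%:R)%:C :> R[i] by rewrite rmorph_nat.
    rewrite -[1]/(1%:C) -rmorphD lecR ltW // archi_boundP // addr_ge0 //.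
    by rewrite -lecR e1 normr_ge0.
  by move=> [y n] /= [yM Mn]; apply: le_trans yM _; rewrite ler_nat.
move=> n _ Hn; exists n%:R => // s Ks; rewrite rmorph_nat; exact: (Hn n (leqnn n) s Ks).
Qed.
End Limits.

(** * Truncated sums on the strip *)

(** The product of the sums of [t] over [r] contains all terms of the monomial
    function.  The constant [c] absorbs the points of norm greater than 1,
    whose powers are not bounded by the first power. *)
Lemma norm_qsym_le (F : numFieldType) (I : eqType) (f t : I -> F) (c : F)
    (r : seq I) (a : seq nat) :
  0 <= c ->
  (forall i, i \in r -> 0 <= t i /\
    forall b, (0 < b)%N -> `|f i| ^+ b <= c ^+ b * t i) ->
  is_index a ->
  `|qsym (map f r) a| <= c ^+ sumn a * (\sum_(i <- r) t i) ^+ size a.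
Proof.
move=> c0; elim: r a => [|i r IH] a Hr ia.
  by case: a ia => [|b a] _ /=; rewrite ?normr1 ?mulr1 ?normr0 // big_nil exprS mul0r mulr0.
case: a ia => [|b a] /=; first by rewrite normr1 mulr1.
move=> /andP[b0 ia]; have [ti fi] := Hr i (mem_head _ _).
have Hr' j : j \in r -> 0 <= t j /\ forall b, (0 < b)%N -> `|f j| ^+ b <= c ^+ b * t j.
  by move=> jr; apply: Hr; rewrite inE jr orbT.
have T0 : 0 <= \sum_(j <- r) t j.
  by rewrite big_seq sumr_ge0 // => j /Hr'[].
rewrite big_cons; set T := \sum_(j <- r) t j in T0 *.
have IHb := IH (b :: a) Hr'; rewrite {1}/is_index /= b0 in IHb.
apply: le_trans (ler_normD _ _) _; rewrite normrM normrX.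
apply: (le_trans (lerD (IHb ia) (ler_pM _ _ (fi _ b0) (IH a Hr' ia)))).
- by rewrite exprn_ge0.
- by [].
have -> : c ^+ (b + sumn a) * T ^+ (size a).+1 +
    c ^+ b * t i * (c ^+ sumn a * T ^+ size a) =
  c ^+ (b + sumn a) * ((t i + T) * T ^+ size a) by rewrite exprD exprS; ring.
rewrite ler_wpM2l ?exprn_ge0 // exprS ler_wpM2l ?addr_ge0 //.
by rewrite lerXn2r ?nnegrE ?addr_ge0 // lerDr.
Qed.

Section StripBounds.
Variable R : realType.
Implicit Types (s : R[i]) (a : seq nat).
Local Notation L := (@succ_ln R).

(** The real part of n + s exceeds n - 1/2, hence is at least n / 2. *)
Lemma strip_norm_inv s n : strip s -> (0 < n)%N ->
  `|(n%:R + s)^-1| <= (2 / n%:R : R)%:C.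
Proof.
move=> ss n0; have n0' : 0 < n%:R :> R by rewrite ltr0n.
have H : (n%:R / 2 : R)%:C <= `|n%:R + s|.
  apply: le_trans (normc_ge_Re _); rewrite lecR.
  have -> : complex.Re (n%:R + s) = n%:R + complex.Re s.
    by rewrite raddfD /= -(rmorph_nat (real_complex R)).
  apply: le_trans (ler_norm _).
  have : 1 <= n%:R :> R by rewrite ler1n.
  move: ss; rewrite /strip /= ltr_norml => /andP[].
  lra.
have p : 0 < (n%:R / 2 : R)%:C by rewrite ltcR divr_gt0.
rewrite normfV -[2 / n%:R]invf_div fmorphV /= lef_pV2 ?posrE //.
exact: lt_le_trans p H.
Qed.

Lemma strip_norm_inv_exp s n b : strip s -> (0 < n)%N -> 
  `|(n%:R + s)^-1| ^+ b <= ((2 / n%:R) ^+ b : R)%:C.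
Proof.
move=> ss n0; rewrite rmorphXn /= lerXn2r ?nnegrE //; last exact: strip_norm_inv.
by rewrite ler0c divr_ge0.
Qed.

Lemma norm_zeta_trunc_le s N a : strip s -> is_index a ->
  `|zeta_trunc N a s| <= (2 ^+ sumn a * L N ^+ size a)%:C.
Proof.
move=> ss ia; rewrite zeta_truncE /shifted_inverses.
apply: (@le_trans _ _ (2 ^+ sumn a *
    (\sum_(n <- iota 1 N.-1) (n%:R^-1 : R)%:C) ^+ size a)).
  apply: norm_qsym_le => // n; rewrite mem_iota => /andP[n0 _].
  have n0' : 1 <= n%:R :> R by rewrite ler1n.
  split=> [|b b0]; first by rewrite ler0c invr_ge0.
  apply: le_trans (strip_norm_inv_exp b ss n0) _.
  rewrite -(rmorph_nat (real_complex R)) -rmorphXn -rmorphM lecR.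
  rewrite exprMn ler_wpM2l ?exprn_ge0 //.
  case: b b0 => // b _; rewrite exprS ler_piMr ?invr_ge0 //.
  by rewrite exprn_ile1 ?invr_ge0 // invf_le1 // (lt_le_trans ltr01).
rewrite -rmorph_sum rmorphM /= !rmorphXn /= rmorph_nat ler_wpM2l ?exprn_ge0 //.
rewrite -!rmorphXn lecR lerXn2r ?nnegrE ?(ltW (succ_ln_gt0 _ _)) //.
  by rewrite sumr_ge0 // => i _; rewrite invr_ge0.
by rewrite -subn1; exact: harmonic_le_succ_ln.
Qed.

Lemma zeta_trunc_rcons s N a b : (0 < N)%N ->
  zeta_trunc N.+1 (rcons a b) s =
  zeta_trunc N (rcons a b) s + (N%:R + s)^-1 ^+ b * zeta_trunc N a s.
Proof.
move=> N0; rewrite !zeta_truncE /shifted_inverses /=.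
have -> : iota 1 N = rcons (iota 1 N.-1) N.
  by case: N N0 => // N _; have := iotaD 1 N 1; rewrite addn1 add1n => ->; rewrite cats1.
by rewrite map_rcons qsym_rcons.
Qed.

Lemma zeta_trunc_nil s N : zeta_trunc N [::] s = 1.
Proof. by rewrite zeta_truncE qsym_nil. Qed.

(** The exponent is an integer in order to cover depth 0, where it is -1. *)
Definition log_gauge (d N : nat) : R := L N ^ (d%:Z - 1) / N%:R.

Lemma log_gaugeS p N : log_gauge p.+1 N = L N ^+ p / N%:R.
Proof. by rewrite /log_gauge -addn1 PoszD addrK. Qed.

Lemma log_gauge_ge0 d N : 0 <= log_gauge d N.
Proof. by rewrite divr_ge0 // exprz_ge0 // ltW // succ_ln_gt0. Qed.

Lemma log_gauge_le d e N : (d <= e)%N -> log_gauge d N <= log_gauge e N.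
Proof.
move=> de; rewrite ler_wpM2r ?invr_ge0 // ler_weXz2l ?succ_ln_ge1 //.
by rewrite lerD2r.
Qed.

Lemma log_gauge_mul d l N : log_gauge d N * L N ^+ l = log_gauge (d + l) N.
Proof.
rewrite /log_gauge mulrAC; congr (_ / _).
rewrite -[_ ^+ l]/(L N ^ l%:Z) -expfzDr ?gt_eqF ?succ_ln_gt0 //.
by rewrite PoszD addrAC.
Qed.

Lemma log_gauge_small C d : 0 <= C -> arbitrarily_small (fun N => C * log_gauge d N).
Proof.
move=> C0 e e0.
have [n n0 Hn] := succ_ln_pow_small d (divr_gt0 e0 (ltr_wpDl C0 ltr01)).
exists n => //; rewrite -log_gaugeS ler_pdivlMr ?ltr_wpDl // in Hn.
apply: le_trans Hn; rewrite mulrC ler_pM ?log_gauge_ge0 ?log_gauge_le //.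
by rewrite lerDl.
Qed.

(** The terms of the tail have their largest index i between [N] and [M]; the
    last exponent being at least 2, they sum to at most a multiple of
    (1 + ln i)^{d-1} / i^2 for each i. *)
Lemma zeta_trunc_cauchy a : admissible a -> exists2 C : R, 0 <= C &
  forall s N M, strip s -> (0 < N <= M)%N ->
    `|zeta_trunc M a s - zeta_trunc N a s| <= (C * log_gauge (size a) N)%:C.
Proof.
case/lastP: a => [_|a b].
  exists 0 => // s N M _ _; by rewrite !zeta_trunc_nil subrr normr0 mul0r.
rewrite /admissible /is_index all_rcons last_rcons => /andP[/andP[_ ia] b2].
have [C C0 HC] := @succ_ln_tail R (size a).
set D := 2 ^+ b * 2 ^+ sumn a : R.
have D0 : 0 <= D by rewrite mulr_ge0 ?exprn_ge0.
exists (D * C) => [|s N M ss]; first by rewrite mulr_ge0.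
move=> /andP[N0 NM]; rewrite size_rcons log_gaugeS -mulrA.
apply: (@le_trans _ _ (D * \sum_(N <= i < M) L i ^+ size a / i%:R ^+ 2)%:C); last first.
  by rewrite lecR ler_wpM2l // HC.
elim: M NM => [|M IH]; first by rewrite leqNgt N0.
rewrite leq_eqVlt ltnS => /orP[/eqP <-|NM].
  by rewrite subrr normr0 big_geq // mulr0.
rewrite zeta_trunc_rcons ?(leq_trans N0) // big_nat_recr //= addrAC.
apply: le_trans (ler_normD _ _) _; rewrite mulrDr rmorphD lerD ?IH //.
rewrite normrM normrX.
have M0 : (0 < M)%N by apply: leq_trans NM.
have M0' : 1 <= M%:R :> R by rewrite ler1n.
apply: (le_trans (ler_pM _ _ (strip_norm_inv_exp b ss M0) (norm_zeta_trunc_le M ss ia))).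
- by rewrite exprn_ge0.
- by [].
rewrite -rmorphM lecR /D.
have -> : (2 / M%:R) ^+ b * (2 ^+ sumn a * L M ^+ size a) =
   2 ^+ b * 2 ^+ sumn a * (L M ^+ size a * (M%:R^-1) ^+ b) by rewrite exprMn; ring.
rewrite ler_wpM2l // ler_wpM2l ?exprn_ge0 ?(ltW (succ_ln_gt0 _ _)) //.
rewrite -exprVn ler_wiXn2l ?invr_ge0 // invf_le1 //.
exact: lt_le_trans ltr01 M0'.
Qed.

Lemma zeta_dist a : admissible a -> exists2 C : R, 0 <= C &
  forall s N, strip s -> (0 < N)%N ->
    `|zeta_trunc N a s - zeta a s| <= (C * log_gauge (size a) N)%:C.
Proof.
move=> /zeta_trunc_cauchy[C C0 HC]; exists C => // s N ss N0; rewrite distrC.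
apply: (complex_limit_dist (u := fun N => zeta_trunc N a s)
  (B := fun N => C * log_gauge (size a) N)) => //.
  by move=> n m; apply: HC.
exact: log_gauge_small.
Qed.

(** The terms 1/n - 1/(n + s) = s / (n (n + s)) are at most 2 |s| / n^2, so the
    tail is uniformly small once |s| is bounded. *)
Lemma harmonic_fun_dist (M : R) : 0 <= M -> exists2 C : R, 0 <= C &
  forall s N, strip s -> `|s| <= M%:C -> (0 < N)%N ->
  `|harmonic_fun s - \sum_(1 <= n < N) (n%:R^-1 - (n%:R + s)^-1)|
    <= (C * log_gauge 1 N)%:C.
Proof.
move=> M0; have [C C0 HC] := @succ_ln_tail R 0.
have D0 : 0 <= M * 2 * C by rewrite !mulr_ge0.
exists (M * 2 * C) => // s N ss sM N0.
apply: (complex_limit_dist (u := fun N => \sum_(1 <= n < N) (n%:R^-1 - (n%:R + s)^-1))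
  (B := fun N => M * 2 * C * log_gauge 1 N)) => //; last exact: log_gauge_small.
move=> n m /andP[n0 nm]; rewrite (big_cat_nat n0 nm) /= addrAC subrr add0r.
rewrite log_gaugeS -mulrA; apply: le_trans (ler_norm_sum _ _ _) _.
apply: (@le_trans _ _ (M * 2 * \sum_(n <= i < m) L i ^+ 0 / i%:R ^+ 2)%:C); last first.
  by rewrite lecR ler_wpM2l ?HC // mulr_ge0.
rewrite mulr_sumr rmorph_sum !big_nat ler_sum // => i /andP[ni _].
have i0 : (0 < i)%N by exact: leq_trans ni.
have H := strip_norm_inv ss i0.
have i0' : i%:R != 0 :> R[i] by rewrite pnatr_eq0 -lt0n.
have is0 : i%:R + s != 0.
  apply/eqP => is0; have := normc_ge_Re (i%:R + s).
  rewrite raddfD /= -(rmorph_nat (real_complex R)) /= rmorph_nat is0 normr0.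
  have : 1 <= i%:R :> R by rewrite ler1n.
  move: ss; rewrite /strip /= ltr_norml -[0]/(0%:C) lecR normr_le0.
  move=> /andP[s1 s2] i1 /eqP.
  lra.
have -> : i%:R^-1 - (i%:R + s)^-1 = s * i%:R^-1 * (i%:R + s)^-1.
  by field; rewrite i0' is0.
rewrite !normrM normfV normr_nat /=.
have -> : (M * 2 * (L i ^+ 0 / i%:R ^+ 2))%:C = M%:C * i%:R^-1 * (2 / i%:R)%:C.
  rewrite -(rmorph_nat (real_complex R)) -fmorphV -!rmorphM; congr _%:C.
  by rewrite expr0; field; rewrite pnatr_eq0 -lt0n.
by rewrite ler_pM ?mulr_ge0 ?invr_ge0 // ler_wpM2r ?invr_ge0.
Qed.

Lemma zeta_trunc1 s N :
  zeta_trunc N [:: 1%N] s = \sum_(1 <= n < N) (n%:R + s)^-1.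
Proof.
rewrite -[LHS]/(zeta_from N s 0 [:: 1%N]) zeta_from_cons.
by apply: eq_bigr => n _; rewrite zeta_from_nil mulr1.
Qed.

End StripBounds.

(** * Uniform asymptotics *)

Section UniformO.
Variable R : realType.
Variable K : set R[i].
Implicit Types (f : nat -> R[i] -> R[i]) (g : nat -> R).
Local Notation L := (@succ_ln R).

Definition uniformO g f := exists2 C : R, 0 <= C &
  forall N s, (0 < N)%N -> K s -> `|f N s| <= (C * g N)%:C.

Lemma uniformO_ext g f1 f2 :
  (forall N s, (0 < N)%N -> K s -> f1 N s = f2 N s) -> uniformO g f1 -> uniformO g f2.
Proof. by move=> e [C C0 H]; exists C => // N s N0 Ks; rewrite -e // H. Qed.

Lemma uniformO_le g1 g2 f :
  (forall N, (0 < N)%N -> g1 N <= g2 N) -> uniformO g1 f -> uniformO g2 f.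
Proof.
move=> le [C C0 H]; exists C => // N s N0 Ks; apply: le_trans (H N s N0 Ks) _.
by rewrite lecR ler_wpM2l // le.
Qed.

Lemma uniformO0 g : uniformO g (fun _ _ => 0).
Proof. by exists 0 => // N s _ _; rewrite normr0 mul0r. Qed.

Lemma uniformO_cst (c : R[i]) : uniformO (fun=> 1) (fun _ _ => c).
Proof.
exists (complex.Re `|c|) => [|N s _ _].
  by rewrite -lecR RRe_real ?normr_real ?normr_ge0.
by rewrite mulr1 RRe_real ?normr_real.
Qed.

Lemma uniformOD g f1 f2 : uniformO g f1 -> uniformO g f2 ->
  uniformO g (fun N s => f1 N s + f2 N s).
Proof.
move=> [C C0 H] [D D0 H']; exists (C + D) => [|N s N0 Ks]; first exact: addr_ge0.
by rewrite (le_trans (ler_normD _ _)) // mulrDl rmorphD lerD ?H ?H'.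
Qed.

Lemma uniformOM g1 g2 f1 f2 : uniformO g1 f1 -> uniformO g2 f2 ->
  uniformO (fun N => g1 N * g2 N) (fun N s => f1 N s * f2 N s).
Proof.
move=> [C C0 H] [D D0 H']; exists (C * D) => [|N s N0 Ks]; first exact: mulr_ge0.
rewrite normrM mulrACA rmorphM ler_pM ?H ?H' //.
Qed.

Lemma uniformO_scale c g f : uniformO g f -> uniformO g (fun N s => c * f N s).
Proof.
move=> Of; apply: uniformO_le (uniformOM (uniformO_cst c) Of) => N _.
by rewrite mul1r.
Qed.

Lemma uniformO_sum (I : eqType) (r : seq I) g (F : I -> nat -> R[i] -> R[i]) :
  {in r, forall i, uniformO g (F i)} -> uniformO g (fun N s => \sum_(i <- r) F i N s).
Proof.
elim: r => [|i r IH] H.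
  by apply: uniformO_ext (uniformO0 g) => N s _ _; rewrite big_nil.
apply: uniformO_ext (uniformOD (H i (mem_head _ _)) (IH _)).
  by move=> N s _ _; rewrite big_cons.
by move=> j jr; apply: H; rewrite inE jr orbT.
Qed.

Lemma uniformOX l f : uniformO L f ->
  uniformO (fun N => L N ^+ l) (fun N s => f N s ^+ l).
Proof.
move=> Of; elim: l => [|l IH]; first exact: uniformO_cst 1.
apply: uniformO_ext (uniformO_le _ (uniformOM Of IH)) => [N s _ _|N _]; by rewrite exprS.
Qed.

(** Telescoping a power: x^{l+1} - y^{l+1} = (x - y) x^l + (x^l - y^l) y, where
    the error 1 / N of the difference is multiplied by l logarithms. *)
Lemma uniformO_subX l f1 f2 : uniformO L f1 -> uniformO L f2 ->
  uniformO (log_gauge R 1) (fun N s => f1 N s - f2 N s) ->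
  uniformO (log_gauge R l) (fun N s => f1 N s ^+ l - f2 N s ^+ l).
Proof.
move=> O1 O2 Od; elim: l => [|l IH].
  by apply: uniformO_ext (uniformO0 _) => N s _ _; rewrite subrr.
apply: uniformO_ext (uniformOD (uniformO_le _ (uniformOM Od (uniformOX l O1)))
  (uniformO_le _ (uniformOM IH O2))).
- by move=> N s _ _ /=; rewrite !exprS; ring.
- by move=> N _; rewrite log_gauge_mul.
by move=> N _; rewrite -[L N]expr1 log_gauge_mul addn1.
Qed.

End UniformO.

Section Asymptotics.
Variable R : realType.
Variable K : set R[i].
Variable M : R.
Hypothesis M0 : 0 <= M.
Hypothesis KM : forall s, K s -> `|s| <= M%:C.
Hypothesis KL : K `<=` @strip R.
Local Notation L := (@succ_ln R).
Local Notation log_gauge := (@log_gauge R).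
Local Notation uniformO := (uniformO K).

Lemma uniformO_zeta_trunc a : is_index a ->
  uniformO (fun N => L N ^+ size a) (fun N s => zeta_trunc N a s).
Proof.
move=> ia; exists (2 ^+ sumn a) => [|N s _ /KL ss]; first exact: exprn_ge0.
exact: norm_zeta_trunc_le.
Qed.

Lemma uniformO_zeta_error a : admissible a ->
  uniformO (log_gauge (size a)) (fun N s => zeta_trunc N a s - zeta a s).
Proof. by move=> /(zeta_dist R)[C C0 H]; exists C => // N s N0 /KL ss; apply: H. Qed.

(** Comparison with the truncation at N = 1, itself bounded on the strip. *)
Lemma uniformO_zeta a : admissible a -> uniformO (fun=> 1) (fun _ s => zeta a s).
Proof.
move=> aa; have [C C0 H] := uniformO_zeta_error aa.
have [D D0 H'] := uniformO_zeta_trunc (proj1 (andP aa)).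
exists (D * L 1 ^+ size a + C * log_gauge (size a) 1) => [|N s _ Ks].
  by rewrite addr_ge0 // mulr_ge0 ?log_gauge_ge0 // exprn_ge0 // ltW // succ_ln_gt0.
rewrite mulr1 -(subKr (zeta_trunc 1 a s) (zeta a s)) (le_trans (ler_normB _ _)) //.
by rewrite rmorphD lerD ?H ?H'.
Qed.

Lemma uniformO_error1 : uniformO (log_gauge 1)
  (fun N s => zeta_trunc N [:: 1%N] s - (harmonic_trunc R N - harmonic_fun s)).
Proof.
have [C C0 H] := harmonic_fun_dist M0; exists C => // N s N0 Ks.
rewrite zeta_trunc1; apply: le_trans (H s N (KL Ks) (KM Ks) N0).
rewrite sumrB /harmonic_trunc opprB opprD opprK.
by rewrite le_eqVlt; apply/orP; left; apply/eqP; congr `|_|; ring.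
Qed.

Lemma uniformO_regularized1 : uniformO L (fun N s => harmonic_trunc R N - harmonic_fun s).
Proof.
have O1 : uniformO L (fun N s =>
    -1 * (zeta_trunc N [:: 1%N] s - (harmonic_trunc R N - harmonic_fun s))).
  apply/uniformO_scale/(uniformO_le _ uniformO_error1) => N N0.
  rewrite log_gaugeS expr0 (@le_trans _ _ 1) ?succ_ln_ge1 // mul1r invf_le1 ?ler1n //.
  by rewrite ltr0n.
apply: uniformO_ext (uniformOD (uniformO_zeta_trunc (isT : is_index [:: 1%N])) O1).
by move=> N s _ _ /=; ring.
Qed.

Lemma uniformO_decomp_coeff_error d (u : words) : in_H0 u -> depth_le d u ->
  uniformO (log_gauge d)
    (fun N s => lin_eval (fun a => zeta_trunc N a s) u - zeta_lin u s).
Proof.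
move=> uH ud.
apply: (uniformO_ext (f1 := fun N s =>
  \sum_(a <- dom u) ratr (coeff a u) * (zeta_trunc N a s - zeta a s))).
  by move=> N s _ _; rewrite -sumrB; apply: eq_bigr => a _; rewrite mulrBr.
apply: uniformO_sum => a au; apply: uniformO_scale.
apply: uniformO_le (uniformO_zeta_error (allP uH a au)) => N _.
exact: log_gauge_le (allP ud a au).
Qed.

Lemma uniformO_zeta_lin (u : words) : in_H0 u -> uniformO (fun=> 1) (fun _ s => zeta_lin u s).
Proof.
move=> uH; apply: uniformO_sum => a au; apply: uniformO_scale.
exact: uniformO_zeta (allP uH a au).
Qed.

(** Each coefficient u_l of the decomposition has depth at most r - l, so its
    truncation error is (1 + ln N)^{r-l-1} / N; the l-th power of the sum of
    depth one restores l logarithms.  The error on that sum itself contributes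
    (1 + ln N)^{l-1} / N, which is at most
    as large. *)
Lemma uniformO_zeta_star k : is_index k ->
  uniformO (log_gauge (size k)) (fun N s => zeta_trunc N k s
       - zeta_star (harmonic_trunc R N - harmonic_fun s) k s).
Proof.
move=> ik; have [HU _] := stuffle_decompP ik.
pose X N s : R[i] := harmonic_trunc R N - harmonic_fun s.
pose Z1 N s : R[i] := zeta_trunc N [:: 1%N] s.
pose u := stuffle_decomp k.
apply: (uniformO_ext (f1 := fun N s => \sum_(l < (size k).+1)
   ((lin_eval (fun a => zeta_trunc N a s) (u l) - zeta_lin (u l) s) * Z1 N s ^+ l
     + zeta_lin (u l) s * (Z1 N s ^+ l - X N s ^+ l)))).
  move=> N s _ _; rewrite (lin_eval_decomp (f := fun a => zeta_trunc N a s)) //.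
  - by rewrite -sumrB; apply: eq_bigr => l _; rewrite -/(X N s) -/(Z1 N s) -/u; ring.
  - exact: zeta_trunc_nil.
  move=> v w; rewrite !zeta_truncE qsym_stuffle.
  by apply: eq_bigr => z _; rewrite zeta_truncE.
apply: uniformO_sum => l _; have [uH ud] := HU l.
have ls : (l <= size k)%N by rewrite -ltnS.
have O1 : uniformO L Z1 by exact: (uniformO_zeta_trunc (isT : is_index [:: 1%N])).
apply: uniformOD.
  apply: uniformO_le
    (uniformOM (uniformO_decomp_coeff_error uH ud) (uniformOX l O1)) => N _.
  by rewrite log_gauge_mul subnK.
apply: uniformO_le (uniformOM (uniformO_zeta_lin uH)
  (uniformO_subX l O1 uniformO_regularized1 uniformO_error1)) => N _.
by rewrite mul1r log_gauge_le.
Qed.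
End Asymptotics.

Unset Implicit Arguments.

Theorem theorem2p4 (R : realType) (k : seq nat) (hk : is_index k)
    (K : set R[i]^o) (hK : compact K) (hKL : K `<=` @strip R) :
  exists C : R, \forall N \near \oo, forall s : R[i], K s ->
    `| zeta_trunc N k s
       - zeta_star (harmonic_trunc R N - harmonic_fun s) k s |
    <= (C * ((1 + ln N%:R) ^ ((size k)%:Z - 1) / N%:R))%:C.
Proof.
have [M M0 KM] := compact_normc_bounded hK.
have [C _ HC] := uniformO_zeta_star M0 KM hKL hk.
by exists C; exists 1%N => // N N0 s Ks; apply: HC.
Qed.
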